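(* Let $(m,n)$ be a coprime pair of positive integers. Suppose $\sigma$ is the SW-sequence of $R\in\mathfrak{R}^+_{m,n}$, $R\ne R_0$, and $\sigma^L$ is the SW-sequence of $\mathcal{L}(R)$. Let $s=\sigma^{-1}(W_1)$ and $\delta=\delta(R)$, and let $\mathfrak r_2$ be the second smallest element of $R$. Then \begin{enumerate} \item[i)] $R$ can be recovered from the pair $(\mathcal{L}(R),\sigma)$ by $R=\big((\mathfrak r_2+\mathcal{L}(R))\setminus\{m+n\}\big)\cup\{0\}$, where $n-\mathfrak r_2$ is equal to the $(s-1)$-st smallest element of $\mathcal{L}(R)$. \item[ii)] $\sigma^L$ is obtained from $\sigma$ by inserting a $W$ after $S_{\mathrm{key}(R)}$, which gives the same word as inserting a $W$ after $\sigma_\delta$, and then removing $\sigma_s=W$. \item[iii)] $\sigma$ is obtained from $\sigma^L$ by removing $\sigma^L_\delta=W$ and then inserting a $W$ after the letter in position $s-1$. \end{enumerate}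
   Context: The rank of a lattice point $(a,b)$ is $mb-na$. $\mathfrak{R}^+_{m,n}$ is the set of rank sets of $(m,n)$-Dyck paths: an $(m,n)$-Dyck path $D$ is a lattice path $P_0=(0,0),\dots,P_{m+n}=(m,n)$ with steps $u=(0,1)$, $d=(1,0)$ never going below $y=\frac nm x$, and its rank set $R=R(D)$ is the set of ranks of $P_0,\dots,P_{m+n-1}$ ($m+n$ distinct nonnegative integers, smallest $0$). The path is determined by its rank set. $R_0=\{0,1,\dots,m+n-1\}$ is the rank set of the unique Dyck path of area $0$. $S(R)=R\cap(R-m)$ and $W(R)=R\cap(R+n)$ are the sets of ranks of starting points of $u$ steps and of $d$ steps, and $R=S(R)\uplus W(R)$. With $\mathfrak r_1<\dots<\mathfrak r_{m+n}$ the elements of $R$ in increasing order, the SW-sequence $\sigma(R)=(\sigma_1,\dots,\sigma_{m+n})$ has $\sigma_i=S$ if $\mathfrak r_i\in S(R)$ and $\sigma_i=W$ if $\mathfrak r_i\in W(R)$. $S_i$ (resp. $W_j$) denotes the $i$-th $S$ (resp. $j$-th $W$) of $\sigma$ from the left, and $\sigma^{-1}(W_1)$ is the position of the first $W$. For $R_0\ne R\in\mathfrak{R}^+_{m,n}$ the left operation is $\mathcal{L}(R)=\big((R\setminus\{0\})\cup\{m+n\}\big)-\min(R\setminus\{0\})$ (the subtraction is applied to every element); one has $\mathcal{L}(R)\in\mathfrak{R}^+_{m,n}$. For a set $X$ and number $t$, $t+X=\{t+x:x\in X\}$. Finally $\delta(R)=|R\cap\{0,1,\dots,m+n\}|$ and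 $\mathrm{key}(R)=|S(R)\cap\{0,1,\dots,m+n\}|$. *)

(* Defs.v *)
From HB Require Import structures.
From mathcomp Require Import all_boot all_order all_algebra finmap.

Set Implicit Arguments.
Unset Strict Implicit.
Unset Printing Implicit Defensive.

Import Order.TTheory GRing.Theory Num.Theory.
Local Open Scope fset_scope.
Local Open Scope ring_scope.

(* true is the step u = (0, 1), false is the step d = (1, 0). *)
Definition path_point (D : seq bool) (i : nat) : nat * nat :=
  (count_mem false (take i D), count_mem true (take i D)).

Definition rank (m n : nat) (P : nat * nat) : int :=
  m%:Z * P.2%:Z - n%:Z * P.1%:Z.

(* Weak position above the line is only tested at the lattice points of the
   path; this suffices since the steps are vertical or horizontal. *)
Definition is_dyck (m n : nat) (D : seq bool) : Prop :=
  path_point D (size D) = (m, n) /\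
  forall i, (i <= size D)%N ->
    n%:R / m%:R * (path_point D i).1%:R <= (path_point D i).2%:R :> rat.

Definition rank_set (m n : nat) (D : seq bool) : {fset int} :=
  [fset rank m n (path_point D i) | i in iota 0 (m + n)].

Definition is_rank_set (m n : nat) (R : {fset int}) : Prop :=
  exists D : seq bool, is_dyck m n D /\ R = rank_set m n D.

Definition R0 (m n : nat) : {fset int} := [fset i%:Z | i in iota 0 (m + n)].

Definition translate (t : int) (X : {fset int}) : {fset int} :=
  [fset t + x | x in X].

Definition Sset (m : nat) (R : {fset int}) : {fset int} :=
  R `&` translate (- m%:Z) R.

Definition Wset (n : nat) (R : {fset int}) : {fset int} :=
  R `&` translate n%:Z R.

Definition increasing (R : {fset int}) : seq int := sort <=%O (enum_fset R).

(* Counted from k = 1. *)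
Definition kth_smallest (k : nat) (R : {fset int}) : int :=
  nth 0 (increasing R) k.-1.

Inductive letter : Type := LS | LW.

Definition letter_is_W (a : letter) : bool := if a is LW then true else false.
Definition letter_of_bool (b : bool) : letter := if b then LW else LS.

Lemma letter_is_WK : cancel letter_is_W letter_of_bool.
Proof. by case. Qed.

HB.instance Definition _ := Equality.copy letter (can_type letter_is_WK).

(* On a rank set R of a Dyck path, R is the disjoint union of Sset m R and
   Wset n R, so the letter is LS exactly on Sset m R. *)
Definition SW_seq (m n : nat) (R : {fset int}) : seq letter :=
  [seq if r \in Wset n R then LW else LS | r <- increasing R].

Definition left_op (m n : nat) (R : {fset int}) : {fset int} :=
  translate (- kth_smallest 1 (R `\ 0)) ((R `\ 0) `|` [fset (m + n)%:Z]).

Definition delta (m n : nat) (R : {fset int}) : nat :=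
  #|` [fset x in R | (0 <= x <= (m + n)%:Z)] |.

Definition key (m n : nat) (R : {fset int}) : nat :=
  #|` [fset x in Sset m R | (0 <= x <= (m + n)%:Z)] |.

(* All positions in words are counted from 1. *)
Definition letter_at (w : seq letter) (k : nat) : letter := nth LS w k.-1.

(* The position of the i-th occurrence (i >= 1) of the letter a in w. *)
Definition letter_pos (a : letter) (i : nat) (w : seq letter) : nat :=
  nth 0%N [seq k <- iota 1 (size w) | letter_at w k == a] i.-1.

Definition insert_after (k : nat) (a : letter) (w : seq letter) : seq letter :=
  take k w ++ a :: drop k w.

Definition remove_at (k : nat) (w : seq letter) : seq letter :=
  take k.-1 w ++ drop k w.

(* The position, in insert_after p a w, of the letter which was in position k
   of w. *)
Definition pos_after_insert (p k : nat) : nat :=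
  if (k <= p)%N then k else k.+1.

(* Main.v *)
(* Ranks of distinct points of a path are distinct modulo m + n, and both 0 and
   n are ranks (the last step ends at rank 0, hence is a step d), so no rank
   below n carries a W and n carries the first W.  In increasing order
     R = 0, X, n, Y, Z   with   X < n < Y < m + n < Z,
   and, up to translation, L(R) = X, n, Y, m + n, Z.  Trading 0 for m + n only
   turns the letter of n into S and gives m + n the letter W; the letters on X, Y
   and Z do not change.  So with a = |X| + 1 and U, V the letters of Y, Z, the
   words of R and L(R) are S^a W U V and S^a U W V. *)
Require Import Defs.
From mathcomp Require Import all_boot all_order all_algebra finmap.
From mathcomp Require Import zify.

Set Implicit Arguments.
Unset Strict Implicit.
Unset Printing Implicit Defensive.

Import Order.TTheory GRing.Theory Num.Theory.

Local Open Scope fset_scope.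
Local Open Scope ring_scope.

(** * Sets of integers and their increasing enumerations *)

Lemma in_translate (t x : int) (A : {fset int}) :
  (x \in translate t A) = (x - t \in A).
Proof.
apply/imfsetP/idP => [[y yA ->]|xA]; first by rewrite addrC addKr.
by exists (x - t) => //; rewrite addrC subrK.
Qed.

Lemma in_Wset n (A : {fset int}) x :
  (x \in Wset n A) = (x \in A) && (x - n%:Z \in A).
Proof. by rewrite in_fsetI in_translate. Qed.

Lemma in_Sset m (A : {fset int}) x :
  (x \in Sset m A) = (x \in A) && (x + m%:Z \in A).
Proof. by rewrite in_fsetI in_translate opprK. Qed.

Lemma mem_increasing (A : {fset int}) : increasing A =i A.
Proof. by move=> x; rewrite mem_sort. Qed.

Lemma increasing_sorted (A : {fset int}) : sorted <%O (increasing A).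
Proof. by rewrite sort_lt_sorted fset_uniq. Qed.

Lemma increasing_uniq (A : {fset int}) : uniq (increasing A).
Proof. exact: lt_sorted_uniq (increasing_sorted A). Qed.

Lemma increasing_eq (A : {fset int}) (s : seq int) :
  sorted <%O s -> s =i A -> increasing A = s.
Proof.
move=> s_sorted sA; apply: lt_sorted_eq => // [|x].
  exact: increasing_sorted.
by rewrite mem_increasing sA.
Qed.

Lemma increasing_translate t (A : {fset int}) :
  increasing (translate t A) = [seq t + x | x <- increasing A].
Proof.
apply: increasing_eq => [|x].
  by rewrite sorted_map (eq_sorted (e' := <%O)) ?increasing_sorted // => x y /=;
    rewrite ltrD2l.
rewrite in_translate -mem_increasing -[x in LHS](subrKC t).
exact/mem_map/addrI.
Qed.

(** Serves to turn the cardinalities [delta] and [key] into counts along the increasing list of [R],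
    which can then be computed block by block. *)
Lemma card_fset_count (A B : {fset int}) (P : pred int) :
  B =i [pred x in A | P x] -> #|` B| = count P (increasing A).
Proof.
move=> BE; rewrite cardfE cardE.
rewrite -size_filter -(size_map val) ; apply: perm_size; apply: uniq_perm.
- by rewrite map_inj_uniq ?enum_uniq //; apply: val_inj.
- by rewrite filter_uniq ?increasing_uniq.
move=> x; rewrite mem_filter mem_increasing andbC.
rewrite -[RHS]/(x \in [pred x in A | P x]) -BE.
apply/mapP/idP => [[y _ ->]|xB]; first exact: valP.
by exists [` xB] => //; rewrite mem_enum.
Qed.

(** * Positions, insertions and removals in words *)

Lemma letter_pos_cat (a : letter) (u v : seq letter) :
  letter_pos a (count_mem a u).+1 (u ++ a :: v) = (size u).+1.
Proof.
rewrite /letter_pos size_cat iotaD filter_cat nth_cat /=.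
have -> : size [seq k <- iota 1 (size u) | letter_at (u ++ a :: v) k == a]
  = count_mem a u.
  rewrite size_filter -[u in RHS](mkseq_nth LS) count_map (iotaDl 1 0) count_map.
  apply: eq_in_count => i; rewrite mem_iota add0n /= /letter_at => lti.
  by rewrite nth_cat lti.
by rewrite ltnn subnn /letter_at /= nth_cat add1n /= ltnn subnn /= eqxx.
Qed.

(** Isolates the final run of [LW]: inserting one more [LW] anywhere in that run gives the same
    word. *)
Lemma last_S (u : seq letter) :
  u = nseq (size u) LW \/ exists v j, u = v ++ LS :: nseq j LW.
Proof.
elim: u => [|a u [E|[v [j ->]]]]; first by left.
  by case: a; [right; exists [::], (size u) | left]; rewrite /= -E.
by right; exists (a :: v), j.
Qed.

Lemma insert_after_size k (a : letter) (u v : seq letter) :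
  k = size u -> insert_after k a (u ++ v) = u ++ a :: v.
Proof. by move=> ->; rewrite /insert_after take_size_cat // drop_size_cat. Qed.

Lemma remove_at_size k (a : letter) (u v : seq letter) :
  k = (size u).+1 -> remove_at k (u ++ a :: v) = u ++ v.
Proof.
by move=> ->; rewrite /remove_at take_size_cat // -cat_rcons drop_size_cat
  ?size_rcons.
Qed.

Lemma letter_at_size k (a : letter) (u v : seq letter) :
  k = (size u).+1 -> letter_at (u ++ a :: v) k = a.
Proof. by move=> ->; rewrite /letter_at nth_cat ltnn subnn. Qed.

Lemma nseq_cat_cons T j (x : T) (v : seq T) :
  nseq j x ++ x :: v = x :: nseq j x ++ v.
Proof. by elim: j => //= j ->. Qed.

(** * Ranks along a Dyck path *)

Lemma path_point_size (D : seq bool) i :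
  (i <= size D)%N -> ((path_point D i).1 + (path_point D i).2 = i)%N.
Proof.
move=> leiD; rewrite /= -[RHS](size_takel leiD) -(count_predC (pred1 false)).
by congr addn; apply: eq_count; case.
Qed.

Lemma rank_path_pointS m n (D : seq bool) i : (i < size D)%N ->
  rank m n (path_point D i.+1) =
  rank m n (path_point D i) + (if nth false D i then m%:Z else - n%:Z).
Proof.
move=> ltiD; rewrite /rank /path_point /= (take_nth false) //.
by rewrite -cats1 !count_cat /=; case: nth => /=; lia.
Qed.

(** Each rank is followed along the path by itself plus [m] or minus [n], cyclically since the path
    starts and ends at rank 0. The [k]-th rank is congruent to [m * k] modulo [m + n], and [m] is
    invertible there, whence the last property. *)
Lemma rank_setP m n (R : {fset int}) : (0 < m)%N -> (0 < n)%N ->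
  coprime m n -> is_rank_set m n R ->
  [/\ {in R, forall x, 0 <= x}, 0 \in R, n%:Z \in R,
      {in R, forall x, x - n%:Z \notin R -> x + m%:Z \in R} &
      {in R &, forall x y (z : int), x - y = z * (m + n)%:Z -> x = y}].
Proof.
move=> m_gt0 n_gt0 co_mn [D [[D_end D_above] ->]].
pose r i := rank m n (path_point D i).
have sizeD : size D = (m + n)%N by rewrite -(path_point_size (leqnn (size D))) D_end.
have r_ge0 i : (i <= m + n)%N -> 0 <= r i.
  rewrite -sizeD => /D_above; rewrite mulrAC ler_pdivrMr ?ltr0n //.
  by rewrite -!natrM ler_nat /r /rank; lia.
have r_in i : (i < m + n)%N -> r i \in rank_set m n D.
  by move=> lti; apply/imfsetP; exists i; rewrite //= mem_iota.
have inR x : x \in rank_set m n D -> exists2 i, (i < m + n)%N & x = r i.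
  by case/imfsetP => i /=; rewrite mem_iota => lti ->; exists i.
have rS i : (i < m + n)%N -> r i.+1 = r i + m%:Z \/ r i.+1 = r i - n%:Z.
  rewrite -sizeD => /rank_path_pointS E; rewrite /r E.
  by case: nth; [left | right].
have r0 : r 0%N = 0 by rewrite /r /rank /path_point take0 /= !mulr0.
have rN : r (m + n)%N = 0 by rewrite /r -sizeD D_end /rank /= mulrC subrr.
have r0_in : 0 \in rank_set m n D by rewrite -r0; apply: r_in; lia.
split=> //.
- by move=> _ /inR[i lti ->]; apply/r_ge0/ltnW.
- have lt1 : ((m + n).-1 < m + n)%N by lia.
  have := rS _ lt1; rewrite prednK; last by lia.
  (* A final step [u] would start at rank [- m < 0], so the final step is [d], starting at rank
     [n]. *)
  have := r_ge0 _ (ltnW lt1); rewrite rN => ge0 [|] E; first by lia.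
  by rewrite (_ : n%:Z = r (m + n).-1) ?r_in //; lia.
- move=> _ /inR[i lti ->].
  have rSi_in : r i.+1 \in rank_set m n D.
    have [/r_in //|ltn] := ltnP i.+1 (m + n).
    (* The endpoint [(m, n)] is not listed in the rank set, but its rank 0 is that of the start. *)
    by rewrite (_ : i.+1 = (m + n)%N) ?rN //; lia.
  by case: (rS i lti) => <- //; rewrite rSi_in.
move=> _ _ /inR[i lti ->] /inR[j ltj ->] z.
(* At [(x, y)] with [x + y = k], [m * y - n * x = m * k - (m + n) * x]. *)
have rE k : (k < m + n)%N ->
    r k = m%:Z * k%:Z - (m + n)%:Z * (path_point D k).1%:Z.
  move=> ltk; rewrite -{2}(@path_point_size D k) ?sizeD ?(ltnW ltk) //.
  by rewrite /r /rank; nia.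
rewrite !rE // => E; suff -> : i = j by [].
have: ((m + n)%:Z %| m%:Z * (i%:Z - j%:Z))%Z.
  by apply/dvdzP; eexists (z + (path_point D i).1%:Z - (path_point D j).1%:Z); nia.
rewrite Gauss_dvdzr; last by rewrite coprimezE !absz_nat /coprime gcdnC gcdnDl.
(* Both indices lie below [m + n], so their difference is a multiple of [m + n] only if it is 0. *)
move/dvdzP => [q ijE]; have q0 : q = 0.
  by have [|] := leP q 0; have [|] := leP 0 q; nia.
by move: ijE; rewrite q0 mul0r; lia.
Qed.

(** * The blocks of [R] and of its left shift, and their words *)

Lemma lt_sorted_pivot (c : int) (s t : seq int) :
  sorted <%O s -> sorted <%O t -> all (< c) s -> all (> c) t ->
  sorted <%O (s ++ c :: t).
Proof.
rewrite !lt_sorted_pairwise pairwise_cat /= => -> -> s_lt t_gt.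
rewrite t_gt allrel_consr s_lt !andbT /=; apply/allrelP => x y xs yt.
exact: lt_trans (allP s_lt x xs) (allP t_gt y yt).
Qed.

Lemma rank_set_increasing m n (R : {fset int}) : (0 < m)%N -> (0 < n)%N ->
    coprime m n -> is_rank_set m n R ->
  exists X Y Z : seq int,
    [/\ increasing R = 0 :: X ++ n%:Z :: Y ++ Z,
        increasing ((R `\ 0) `|` [fset (m + n)%:Z])
          = X ++ n%:Z :: Y ++ (m + n)%:Z :: Z,
        all (fun x : int => 0 < x < n%:Z) X,
        all (fun x : int => n%:Z < x < (m + n)%:Z) Y &
        all (fun x : int => (m + n)%:Z < x) Z].
Proof.
move=> m_gt0 n_gt0 co_mn /rank_setP[] // R_ge0 R0_in Rn_in RS R_inj.
(* [m + n] is congruent to the rank 0. *)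
have RN : (m + n)%:Z \notin R.
  by apply/negP => /R_inj/(_ R0_in 1); lia.
pose f (P : pred int) := [seq x <- increasing R | P x].
have f_all P : all P (f P) by apply: filter_all.
have f_sorted P : sorted <%O (f P).
  by apply: (sorted_filter lt_trans); apply: increasing_sorted.
have f_mem P x : (x \in f P) = P x && (x \in R).
  by rewrite mem_filter mem_increasing.
pose X := f (fun x => 0 < x < n%:Z).
pose Y := f (fun x => n%:Z < x < (m + n)%:Z).
pose Z := f (fun x => (m + n)%:Z < x).
have all_X (P : pred int) : (forall x, 0 < x < n%:Z -> P x) -> all P X.
  by move=> H; apply: sub_all (f_all _).
have all_Y (P : pred int) : (forall x, n%:Z < x < (m + n)%:Z -> P x) -> all P Y.
  by move=> H; apply: sub_all (f_all _).
have all_Z (P : pred int) : (forall x, (m + n)%:Z < x -> P x) -> all P Z.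
  by move=> H; apply: sub_all (f_all _).
have sortedL : sorted <%O (X ++ n%:Z :: Y ++ (m + n)%:Z :: Z).
  apply: lt_sorted_pivot; rewrite ?all_cat /= ?f_sorted ?lt_sorted_pivot ?f_sorted //;
    rewrite ?all_X ?all_Y ?all_Z //=; try by move=> x; lia.
  lia.
exists X, Y, Z; split; try exact: f_all.
- apply: increasing_eq => [|x].
    (* The list for [R] is a sublist of 0 followed by the list already sorted in [sortedL]; the
       empty prefix makes 0 a pivot. *)
    apply: (@subseq_sorted _ _ lt_trans _ ([::] ++ 0 :: X ++ n%:Z :: Y ++ (m + n)%:Z :: Z)).
      rewrite /=. apply: cat_subseq => //=; rewrite eqxx.
      by apply: cat_subseq => //; apply: subseq_cons.
    apply: lt_sorted_pivot => //; rewrite !all_cat /= all_cat /=.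
    rewrite ?all_X ?all_Y ?all_Z //=; try by move=> x; lia.
    by lia.
  rewrite inE mem_cat inE mem_cat !f_mem.
  have [xR|xR] := boolP (x \in R); last first.
    rewrite !andbF /= !orbF; apply/negP => /orP[]/eqP E.
    - by rewrite E R0_in in xR.
    - by rewrite E Rn_in in xR.
  rewrite !andbT; have := R_ge0 x xR.
  have: x != (m + n)%:Z by apply: contraNneq RN => <-.
  lia.
- apply: increasing_eq => // x.
  rewrite !inE mem_cat inE mem_cat inE !f_mem.
  have [xR|xR] := boolP (x \in R); last first.
    rewrite !andbF /= !orbF.
    have: x != n%:Z by apply: contraNneq xR => ->.
    lia.
  rewrite !andbT; have := R_ge0 x xR.
  lia.
Qed.

(** Between position [p] of the last [LS] before [V] and position [d] there are only letters [LW],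
    so both insertions lengthen the same run. If [U] has no [LS], then [p = a] and the insertion
    falls before the first [LW], pushing it to position [a + 2]; otherwise that letter stays at
    [a + 1]. *)
Lemma insert_key a (U V : seq letter) : (0 < a)%N ->
  let sigma := nseq a LS ++ LW :: U ++ V in
  let d := (a.+1 + size U)%N in
  let p := letter_pos LS (a + count_mem LS U) sigma in
  insert_after p LW sigma = insert_after d LW sigma /\
  pos_after_insert p a.+1 = (a + (p == a)).+1.
Proof.
case: a => // a _; cbv zeta.
have -> : insert_after (a.+2 + size U) LW (nseq a.+1 LS ++ LW :: U ++ V)
    = nseq a.+1 LS ++ LW :: U ++ LW :: V.
  have := @insert_after_size (a.+2 + size U) LW (nseq a.+1 LS ++ LW :: U) V.
  by rewrite -!catA; apply; rewrite size_cat size_nseq /= addSnnS.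
have [->|[v [j ->]]] := last_S U.
  move: (size U) => j; rewrite count_nseq mul0n addn0.
  have -> : letter_pos LS a.+1 (nseq a.+1 LS ++ LW :: nseq j LW ++ V) = a.+1.
    have := @letter_pos_cat LS (nseq a LS) (LW :: nseq j LW ++ V).
    by rewrite nseq_cat_cons size_nseq count_nseq /= mul1n.
  rewrite insert_after_size ?size_nseq // nseq_cat_cons.
  by split=> //; rewrite /pos_after_insert ltnn eqxx addn1.
rewrite count_cat /= count_nseq mul0n !addn0 -!catA.
have -> : letter_pos LS (a.+1 + (count_mem LS v + 1))
    (nseq a.+1 LS ++ LW :: v ++ LS :: nseq j LW ++ V) = (a.+2 + size v).+1.
  have := @letter_pos_cat LS (nseq a.+1 LS ++ LW :: v) (nseq j LW ++ V).
  rewrite count_cat count_nseq size_cat size_nseq /= mul1n add0n -!catA.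
  by rewrite !addSn !addnS addn0.
split; last by rewrite /pos_after_insert; case: eqP; case: leqP; lia.
have := @insert_after_size (a.+2 + size v).+1 LW
  (nseq a.+1 LS ++ LW :: rcons v LS) (nseq j LW ++ V).
rewrite -!catA /= !cat_rcons => -> //.
  by rewrite nseq_cat_cons.
by rewrite /= size_cat size_nseq /= size_rcons !addnS !addSn.
Qed.

Lemma SW_seq_left_op m n (R : {fset int}) : (0 < m)%N -> (0 < n)%N ->
    coprime m n -> is_rank_set m n R ->
  exists a U V,
    [/\ (0 < a)%N,
        SW_seq m n R = nseq a LS ++ LW :: U ++ V,
        SW_seq m n (left_op m n R) = nseq a LS ++ U ++ LW :: V &
    [/\ delta m n R = (a.+1 + size U)%N,
        key m n R = (a + count_mem LS U)%N,
        R = (translate (kth_smallest 2 R) (left_op m n R) `\ (m + n)%:Z)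
              `|` [fset 0] &
        n%:Z - kth_smallest 2 R = kth_smallest a (left_op m n R)]].
Proof.
move=> m_gt0 n_gt0 co_mn rankR.
have [R_ge0 R0_in Rn_in RS R_inj] := rank_setP m_gt0 n_gt0 co_mn rankR.
have [X [Y [Z [incR incL X_lt Y_lt Z_gt]]]] :=
  rank_set_increasing m_gt0 n_gt0 co_mn rankR.
have R_neg (x : int) : x < 0 -> x \notin R.
  by move=> x_lt0; apply/negP => /R_ge0; lia.
(* No rank is [- n], so 0 starts a step [u]. This is what gives [m + n] its letter [LW] in [gN]. *)
have Rm_in : m%:Z \in R by rewrite -[m%:Z]add0r RS // R_neg; lia.
have RN : (m + n)%:Z \notin R by apply/negP => /R_inj/(_ R0_in 1); lia.
pose L := (R `\ 0) `|` [fset (m + n)%:Z]; rewrite -/L in incL.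
have inL x : (x \in L) = (x \in R) && (x != 0) || (x == (m + n)%:Z).
  by rewrite !inE andbC.
(* [f] and [g] are the letters in [R] and in the untranslated left shift [L]. *)
pose f x := if x \in Wset n R then LW else LS.
pose g x := if x \in Wset n L then LW else LS.
have fE x : x \in R -> f x = if x - n%:Z \in R then LW else LS.
  by move=> xR; rewrite /f in_Wset xR.
have RX x : x \in X -> x \in R.
  by move=> xX; rewrite -mem_increasing incR inE mem_cat xX orbT.
have RYZ x : x \in Y ++ Z -> [/\ x \in R, n%:Z < x & x != (m + n)%:Z].
  move=> xYZ; split.
  - by rewrite -mem_increasing incR inE mem_cat inE xYZ !orbT.
  - by move: xYZ; rewrite mem_cat => /orP[/(allP Y_lt)|/(allP Z_gt)] /=; lia.
  - by move: xYZ; rewrite mem_cat => /orP[/(allP Y_lt)|/(allP Z_gt)] /=; lia.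
have f0 : f 0 = LS by rewrite fE // ifN // R_neg; lia.
have fn : f n%:Z = LW by rewrite fE // subrr R0_in.
have fX : map f X = nseq (size X) LS.
  rewrite -(size_map f); apply/all_pred1P; rewrite all_map; apply/allP => x xX /=.
  by rewrite (fE _ (RX _ xX)) ifN // R_neg //; have /= := allP X_lt x xX; lia.
have gX : map g X = nseq (size X) LS.
  rewrite -(size_map g); apply/all_pred1P; rewrite all_map; apply/allP => x xX /=.
  have /= x_lt := allP X_lt x xX.
  have xn : x - n%:Z < 0 by lia.
  by rewrite /g in_Wset !inL (negPf (R_neg _ xn)) /= ifN //; lia.
have gn : g n%:Z = LS.
  by rewrite /g in_Wset subrr !inL eqxx andbF /= ifN //; lia.
have gN : g (m + n)%:Z = LW.
  rewrite /g in_Wset !inL eqxx orbT (_ : _ - _ = m%:Z) ?Rm_in /=; last by lia.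
  by rewrite ifT //; lia.
have gYZ : {in Y ++ Z, g =1 f}.
  move=> x /RYZ[xR x_gt x_neqN]; rewrite /g /f !in_Wset !inL xR (negPf x_neqN).
  (* The letter of [x] could change only if [x - n] were 0 or [m + n]; the latter would make [x]
     congruent to the rank [n]. *)
  have -> : (x - n%:Z == (m + n)%:Z) = false.
    apply/eqP => E; suff : x = n%:Z by lia.
    by apply: (R_inj _ _ xR Rn_in 1); rewrite mul1r.
  have [-> ->] : x != 0 /\ x - n%:Z != 0 by lia.
  by rewrite !orbF !andbT.
have leftE : left_op m n R = translate (- kth_smallest 2 R) L.
  rewrite /left_op /kth_smallest incR; congr (translate (- _) _).
  rewrite (@increasing_eq _ (X ++ n%:Z :: Y ++ Z)) //.
    by have := increasing_sorted R; rewrite incR => /path_sorted.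
  move=> x; rewrite in_fsetD1 -mem_increasing incR inE.
  have := increasing_uniq R; rewrite incR /= => /andP[not0 _].
  by case: eqP => // ->; apply: negPf.
exists (size X).+1, (map f Y), (map f Z); split=> //.
- have -> : SW_seq m n R = map f (increasing R) by [].
  by rewrite incR map_cons map_cat map_cons map_cat fX f0 fn.
- have -> : SW_seq m n (left_op m n R) = map g (X ++ n%:Z :: Y ++ (m + n)%:Z :: Z).
    (* Letters depend only on differences of elements, so translating [L] keeps its word. *)
    rewrite /SW_seq leftE increasing_translate -map_comp incL; apply: eq_map => x /=.
    rewrite /g !in_Wset !in_translate.
    by rewrite !(addrC _ x) (addrAC x _ (- n%:Z)) !addrK.
  rewrite map_cat map_cons map_cat map_cons gX gn gN nseq_cat_cons /=.
  have /eq_in_map : {in Y ++ Z, g =1 f} by [].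
  rewrite !map_cat => /eqP; rewrite eqseq_cat ?size_map // => /andP[].
  by move=> /eqP-> /eqP->.
split.
- rewrite /delta (@card_fset_count R _ (fun x => 0 <= x <= (m + n)%:Z)).
    rewrite incR /= !count_cat /= count_cat size_map.
    have /eqP -> : count (fun x : int => 0 <= x <= (m + n)%:Z) X == size X.
      by rewrite -all_count; apply: sub_all X_lt => x /=; lia.
    have /eqP -> : count (fun x : int => 0 <= x <= (m + n)%:Z) Y == size Y.
      by rewrite -all_count; apply: sub_all Y_lt => x /=; lia.
    have /eqP -> : count (fun x : int => 0 <= x <= (m + n)%:Z) Z == 0%N.
      rewrite -leqn0 leqNgt -has_count -all_predC.
      by apply: sub_all Z_gt => x /=; lia.
    lia.
  by move=> x; rewrite !inE.
- pose P x := (f x == LS) && (x <= (m + n)%:Z).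
  rewrite /key (@card_fset_count R _ P) => [|x]; last first.
    rewrite !inE in_translate opprK /= /P; have [xR /=|//] := boolP (x \in R).
    rewrite (R_ge0 x xR) fE //=; congr andb.
    (* [x + m] and [x - n] differ by [m + n], so they are not both ranks. *)
    have [xnR|/RS->//] := boolP (x - n%:Z \in R); apply/negP => xmR.
    by have := R_inj _ _ xmR xnR 1; lia.
  have -> : increasing R = (rcons (0 :: X) n%:Z ++ Y) ++ Z.
    by rewrite incR -catA cat_rcons.
  rewrite count_cat.
  have -> : count P Z = 0%N.
    apply/eqP; rewrite -leqn0 leqNgt -has_count -all_predC.
    by apply: sub_all Z_gt => x /=; rewrite /P; lia.
  have -> : count P (rcons (0 :: X) n%:Z ++ Y)
      = count_mem LS (map f (rcons (0 :: X) n%:Z ++ Y)).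
    rewrite count_map; apply: eq_in_count => x; rewrite mem_cat mem_rcons !inE /P.
    move=> xXY; rewrite -[RHS]andbT; congr andb.
    by case/orP: xXY => [/or3P[/eqP->|/eqP->|/(allP X_lt)]|/(allP Y_lt)] /=; lia.
  rewrite map_cat map_rcons map_cons fX f0 fn -cats1 !count_cat /= count_nseq /=.
  lia.
- rewrite leftE.
  apply/fsetP => x; rewrite !inE !in_translate opprK subrK inL.
  have [->|x0] := eqVneq x 0; first by rewrite R0_in orbT.
  rewrite andbT orbF; have [->|//] := eqVneq x (m + n)%:Z; last by rewrite orbF.
  exact: negPf.
(* In [L], [n] comes right after the block [X], at position [(size X).+1] counted from 1. *)
- rewrite leftE {2}/kth_smallest increasing_translate incL.
  rewrite (nth_map 0) ?size_cat /=; last by lia.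
  by rewrite nth_cat ltnn subnn /= addrC.
Qed.

Theorem lemma18 (m n : nat) (hm : (0 < m)%N) (hn : (0 < n)%N)
    (hmn : coprime m n) (R : {fset int}) (hR : is_rank_set m n R)
    (hR0 : R <> R0 m n) :
  let L := left_op m n R in
  let sigma := SW_seq m n R in
  let sigmaL := SW_seq m n L in
  let s := letter_pos LW 1 sigma in
  let d := delta m n R in
  let k := key m n R in
  let p := letter_pos LS k sigma in
  let r2 := kth_smallest 2 R in
  (* the positions referred to below exist *)
  [/\ (1 < s)%N, (0 < k <= count_mem LS sigma)%N & (0 < d <= size sigma)%N] /\
  (* i *)
  (R = (translate r2 L `\ (m + n)%:Z) `|` [fset 0] /\
   n%:Z - r2 = kth_smallest (s - 1) L) /\
  (* ii *)
  [/\ letter_at sigma s = LW,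
      insert_after p LW sigma = insert_after d LW sigma,
      sigmaL = remove_at (pos_after_insert p s) (insert_after p LW sigma) &
      sigmaL = remove_at (pos_after_insert d s) (insert_after d LW sigma)] /\
  (* iii *)
  (letter_at sigmaL d = LW /\
   sigma = insert_after (s - 1) LW (remove_at d sigmaL)).
Proof.
have [a [U [V [a_gt0 sigmaE sigmaLE [dE kE R_eq r2E]]]]] :=
  SW_seq_left_op hm hn hmn hR.
cbv zeta; rewrite sigmaE sigmaLE dE kE.
have [p_d p_s] := insert_key U V a_gt0.
have sE : letter_pos LW 1 (nseq a LS ++ LW :: U ++ V) = a.+1.
  have := @letter_pos_cat LW (nseq a LS) (U ++ V).
  by rewrite count_nseq size_nseq.
rewrite sE p_d p_s subn1.
have sizeLU : size (nseq a LS ++ U) = (a + size U)%N.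
  by rewrite size_cat size_nseq.
have dI : insert_after (a.+1 + size U) LW (nseq a LS ++ LW :: U ++ V)
    = nseq a LS ++ LW :: U ++ LW :: V.
  have := @insert_after_size (a.+1 + size U) LW (nseq a LS ++ LW :: U) V.
  by rewrite -!catA; apply; rewrite size_cat size_nseq /= addSnnS.
split; first split=> //.
- by rewrite count_cat count_nseq /= count_cat; lia.
- by rewrite size_cat size_nseq /= size_cat; lia.
split; first by [].
split; [split | split].
- by rewrite letter_at_size ?size_nseq.
- by [].
(* If [p = a], the letter to remove is the second [LW] of [S^a W W U V]. Comparing this word with
   [S^a W U W V] gives [UV]. *)
- have [pa|_] := eqVneq; last by rewrite addn0 dI remove_at_size ?size_nseq.
  have UV : LW :: U ++ V = U ++ LW :: V.
    move: p_d; rewrite pa insert_after_size ?size_nseq // dI => /eqP.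
    by rewrite eqseq_cat // eqxx => /eqP[].
  have := @remove_at_size a.+2 LW (rcons (nseq a LS) LW) (U ++ V).
  by rewrite size_rcons size_nseq !cat_rcons dI -UV addn1 => ->.
- have -> : pos_after_insert (a.+1 + size U) a.+1 = a.+1.
    by rewrite /pos_after_insert leq_addr.
  by rewrite dI remove_at_size ?size_nseq.
(* Trading 0 for [m + n] keeps the number [d] of elements up to [m + n], so [m + n] is the [d]-th
   one. *)
- by rewrite catA letter_at_size ?sizeLU.
- rewrite catA remove_at_size ?sizeLU // -catA.
  by rewrite insert_after_size ?size_nseq.
Qed.
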